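(* Let $(\mathcal C,\otimes,\mathbf 1)$ be a $\Bbbk$-linear additive monoidal category and let $(V^{(n)},\pi^{(n)})$ and $(V'^{(n)},\pi'^{(n)})$ be two Chebyshev systems in $\mathcal C$, with underlying self-dual objects $V=V^{(1)}$ and $V'=V'^{(1)}$. Suppose $V\cong V'$ as self-dual objects, via $\varphi\colon V\to V'$. Then there are homotopy equivalences $\theta^{(n)}\colon V^{(n)}\to V'^{(n)}$ ($n\ge0$) such that for every $n\ge2$ the morphisms $\theta^{(n-2)}$, $\theta^{(n-1)}\otimes\varphi$, $\theta^{(n)}$, $\theta^{(n-2)}[1]$ form an isomorphism in $\mathcal K^-(\mathcal C)$ from the distinguished triangle $$V^{(n-2)}\xrightarrow{\iota^{(n-2)}}V^{(n-1)}\otimes V\xrightarrow{\pi^{(n)}}V^{(n)}\to V^{(n-2)}[1]$$ to the distinguished triangle $$V'^{(n-2)}\xrightarrow{\iota'^{(n-2)}}V'^{(n-1)}\otimes V'\xrightarrow{\pi'^{(n)}}V'^{(n)}\to V'^{(n-2)}[1].$$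
   Context: $\mathrm{Ch}^-(\mathcal C)$ is the category of bounded above cochain complexes over $\mathcal C$ (with the induced tensor product) and $\mathcal K^-(\mathcal C)$ its homotopy category, with its standard triangulated structure. A self-dual object of $\mathcal C$ is a triple $(V,\mathrm{ev},\mathrm{coev})$ with $V\in\mathcal C$, $\mathrm{coev}\colon\mathbf 1\to V\otimes V$, $\mathrm{ev}\colon V\otimes V\to\mathbf 1$ satisfying $(\mathrm{id}_V\otimes\mathrm{ev})\circ(\mathrm{coev}\otimes\mathrm{id}_V)=\mathrm{id}_V=(\mathrm{ev}\otimes\mathrm{id}_V)\circ(\mathrm{id}_V\otimes\mathrm{coev})$. An isomorphism of self-dual objects $\varphi\colon V\to V'$ is an isomorphism in $\mathcal C$ compatible with the structure maps: $(\varphi\otimes\varphi)\circ\mathrm{coev}=\mathrm{coev}'$ and $\mathrm{ev}'\circ(\varphi\otimes\varphi)=\mathrm{ev}$. A Chebyshev system in $\mathcal C$ consists of a self-dual object $(V,\mathrm{ev},\mathrm{coev})$ in $\mathcal C$, a family of complexes $V^{(n)}\in\mathrm{Ch}^-(\mathcal C)$ ($n\ge0$) with $V^{(0)}=\mathbf 1$ and $V^{(1)}=V$, and chain maps $\pi^{(n)}\colon V^{(n-1)}\otimes V\to V^{(n)}$ for $n\ge1$, such that $\pi^{(1)}\colon\mathbf 1\otimes V\to V$ is the canonical isomorphism and for each $n\ge2$ there is a distinguished triangle $V^{(n-2)}\xrightarrow{\iota^{(n-2)}}V^{(n-1)}\otimes V\xrightarrow{\pi^{(n)}}V^{(n)}\to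 V^{(n-2)}[1]$ in $\mathcal K^-(\mathcal C)$, where $\iota^{(n-2)}:=(\pi^{(n-1)}\otimes\mathrm{id}_V)\circ(\mathrm{id}_{V^{(n-2)}}\otimes\mathrm{coev})$. *)

(* Defs.v *)
From mathcomp Require Import all_boot all_order all_algebra.

Set Implicit Arguments.
Unset Strict Implicit.
Unset Printing Implicit Defensive.

Import Order.TTheory GRing.Theory Num.Theory.
Local Open Scope ring_scope.

Declare Scope cat_scope.
Delimit Scope cat_scope with cat.
Local Open Scope cat_scope.

Reserved Notation "g \oc f" (at level 40, left associativity).
Reserved Notation "A \ox B" (at level 38, left associativity).
Reserved Notation "f \om g" (at level 38, left associativity).

Record linear_category (k : comPzRingType) := LinearCategory {
  obj :> Type;
  mor : obj -> obj -> lmodType k;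
  idm : forall A, mor A A;
  mcomp : forall A B D, mor B D -> mor A B -> mor A D
    where "g \oc f" := (mcomp g f);
  comp1m : forall A B (f : mor A B), idm B \oc f = f;
  compm1 : forall A B (f : mor A B), f \oc idm A = f;
  compA : forall A B D E (h : mor D E) (g : mor B D) (f : mor A B),
    h \oc (g \oc f) = (h \oc g) \oc f;
  comp_linearr : forall A B D (g : mor B D) (a : k) (f f' : mor A B),
    g \oc (a *: f + f') = a *: (g \oc f) + g \oc f';
  comp_linearl : forall A B D (a : k) (g g' : mor B D) (f : mor A B),
    (a *: g + g') \oc f = a *: (g \oc f) + g' \oc f
}.

Arguments mor {k l} A B.
Arguments idm {k l} A.
Arguments mcomp {k l A B D} g f.
Notation "g \oc f" := (mcomp g f) : cat_scope.

(* In a linear category hom sets are inhabited, so this says that A is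
   both initial and terminal. *)
Definition is_zero {k : comPzRingType} {C : linear_category k} (A : C) : Prop :=
  forall B : C, (forall f : mor A B, f = 0) /\ (forall f : mor B A, f = 0).

Definition is_iso {k : comPzRingType} {C : linear_category k} {A B : C}
    (f : mor A B) : Prop :=
  exists g : mor B A, g \oc f = idm A /\ f \oc g = idm B.

Record additive_category (k : comPzRingType) := AdditiveCategory {
  add_base :> linear_category k;
  zobj : add_base;
  zobjP : is_zero zobj;
  dsum : add_base -> add_base -> add_base;
  injl : forall A B, mor A (dsum A B);
  injr : forall A B, mor B (dsum A B);
  projl : forall A B, mor (dsum A B) A;
  projr : forall A B, mor (dsum A B) B;
  projl_injl : forall A B, projl A B \oc injl A B = idm A;
  projr_injr : forall A B, projr A B \oc injr A B = idm B;
  projl_injr : forall A B, projl A B \oc injr A B = 0;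
  projr_injl : forall A B, projr A B \oc injl A B = 0;
  dsum_id : forall A B,
    injl A B \oc projl A B + injr A B \oc projr A B = idm (dsum A B)
}.

Arguments zobj {k a}.
Arguments dsum {k a} A B.
Arguments injl {k a} A B.
Arguments injr {k a} A B.
Arguments projl {k a} A B.
Arguments projr {k a} A B.

(* The monoidal structure is not assumed to be strict; [assoc], [lunit] and
   [runit] are the associator and the unitors, with inverses [assocV],
   [lunitV] and [runitV]. *)
Record monoidal_category (k : comPzRingType) := MonoidalCategory {
  mon_base :> additive_category k;
  mon_unit : mon_base;
  tens : mon_base -> mon_base -> mon_base
    where "A \ox B" := (tens A B);
  tensm : forall A A' B B' : mon_base,
    mor A A' -> mor B B' -> mor (A \ox B) (A' \ox B')
    where "f \om g" := (tensm f g);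
  tensm1 : forall A B, idm A \om idm B = idm (A \ox B);
  tensm_comp : forall (A A' A'' B B' B'' : mon_base)
      (f' : mor A' A'') (f : mor A A') (g' : mor B' B'') (g : mor B B'),
    (f' \oc f) \om (g' \oc g) = (f' \om g') \oc (f \om g);
  tensm_linearl : forall (A A' B B' : mon_base) (a : k)
      (f f' : mor A A') (g : mor B B'),
    (a *: f + f') \om g = a *: (f \om g) + f' \om g;
  tensm_linearr : forall (A A' B B' : mon_base) (a : k)
      (f : mor A A') (g g' : mor B B'),
    f \om (a *: g + g') = a *: (f \om g) + f \om g';
  assoc : forall A B D, mor ((A \ox B) \ox D) (A \ox (B \ox D));
  assocV : forall A B D, mor (A \ox (B \ox D)) ((A \ox B) \ox D);
  assocK : forall A B D, assocV A B D \oc assoc A B D = idm _;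
  assocVK : forall A B D, assoc A B D \oc assocV A B D = idm _;
  assoc_nat : forall (A A' B B' D D' : mon_base)
      (f : mor A A') (g : mor B B') (h : mor D D'),
    assoc A' B' D' \oc ((f \om g) \om h) = (f \om (g \om h)) \oc assoc A B D;
  lunit : forall A, mor (mon_unit \ox A) A;
  lunitV : forall A, mor A (mon_unit \ox A);
  lunitK : forall A, lunitV A \oc lunit A = idm _;
  lunitVK : forall A, lunit A \oc lunitV A = idm _;
  lunit_nat : forall (A A' : mon_base) (f : mor A A'),
    lunit A' \oc (idm mon_unit \om f) = f \oc lunit A;
  runit : forall A, mor (A \ox mon_unit) A;
  runitV : forall A, mor A (A \ox mon_unit);
  runitK : forall A, runitV A \oc runit A = idm _;
  runitVK : forall A, runit A \oc runitV A = idm _;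
  runit_nat : forall (A A' : mon_base) (f : mor A A'),
    runit A' \oc (f \om idm mon_unit) = f \oc runit A;
  pentagon : forall A B D E,
    (idm A \om assoc B D E) \oc assoc A (B \ox D) E \oc (assoc A B D \om idm E)
    = assoc A B (D \ox E) \oc assoc (A \ox B) D E;
  triangle_axiom : forall A B,
    (idm A \om lunit B) \oc assoc A mon_unit B = runit A \om idm B
}.

Arguments mon_unit {k m}.
Arguments tens {k m} A B.
Arguments tensm {k m A A' B B'} f g.
Arguments assoc {k m} A B D.
Arguments assocV {k m} A B D.
Arguments lunit {k m} A.
Arguments lunitV {k m} A.
Arguments runit {k m} A.
Arguments runitV {k m} A.
Notation "A \ox B" := (tens A B) : cat_scope.
Notation "f \om g" := (tensm f g) : cat_scope.

Section LinearityLemmas.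
Context {k : comPzRingType}.

Lemma compmD (C : linear_category k) (A B D : C) (g : mor B D)
  (f f' : mor A B) : g \oc (f + f') = g \oc f + g \oc f'.
Proof. by have := comp_linearr g 1 f f'; rewrite !scale1r. Qed.

Lemma compDm (C : linear_category k) (A B D : C) (g g' : mor B D)
  (f : mor A B) : (g + g') \oc f = g \oc f + g' \oc f.
Proof. by have := comp_linearl 1 g g' f; rewrite !scale1r. Qed.

Lemma compm0 (C : linear_category k) (A B D : C) (g : mor B D) :
  g \oc (0 : mor A B) = 0.
Proof. by apply: (addIr (g \oc 0)); rewrite -compmD !add0r. Qed.

Lemma comp0m (C : linear_category k) (A B D : C) (f : mor A B) :
  (0 : mor B D) \oc f = 0.
Proof. by apply: (addIr (0 \oc f)); rewrite -compDm !add0r. Qed.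

Lemma compmN (C : linear_category k) (A B D : C) (g : mor B D)
  (f : mor A B) : g \oc (- f) = - (g \oc f).
Proof. by apply: (addIr (g \oc f)); rewrite -compmD !addNr compm0. Qed.

Lemma compNm (C : linear_category k) (A B D : C) (g : mor B D)
  (f : mor A B) : (- g) \oc f = - (g \oc f).
Proof. by apply: (addIr (g \oc f)); rewrite -compDm !addNr comp0m. Qed.

Lemma tensm0l (C : monoidal_category k) (A A' B B' : C) (g : mor B B') :
  (0 : mor A A') \om g = 0.
Proof.
by have := tensm_linearl 1 (0 : mor A A') 0 g;
  rewrite !scale1r addr0 -[LHS]addr0 => /addrI.
Qed.

Lemma is_zero_idm (C : linear_category k) (A : C) :
  idm A = 0 -> is_zero A.
Proof.
move=> A0 B; split=> f.
  by rewrite -(compm1 f) A0 compm0.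
by rewrite -(comp1m f) A0 comp0m.
Qed.

End LinearityLemmas.

Section Complexes.
Context {k : comPzRingType} {C : monoidal_category k}.

Record complex := Complex {
  cx :> int -> C;
  diff : forall i : int, mor (cx i) (cx (i + 1));
  diffK : forall i : int, diff (i + 1) \oc diff i = 0;
  bounded_above : exists N : int, forall i : int, N < i -> is_zero (cx i)
}.

Record chain_map (X Y : complex) := ChainMap {
  cm :> forall i : int, mor (X i) (Y i);
  cmP : forall i : int, diff Y i \oc cm i = cm (i + 1) \oc diff X i
}.

Program Definition idc (X : complex) : chain_map X X :=
  ChainMap (cm := fun i => idm (X i)) _.
Next Obligation. by move=> X i; rewrite compm1 comp1m. Qed.

Program Definition compc (X Y Z : complex) (g : chain_map Y Z)
    (f : chain_map X Y) : chain_map X Z :=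
  ChainMap (cm := fun i => g i \oc f i) _.
Next Obligation. by move=> X Y Z g f i; rewrite compA cmP -!compA cmP. Qed.

(* A homotopy is a family X^{i+1} -> Y^i; every integer being of the form
   i + 1, the condition below covers all degrees. *)
Definition homotopic (X Y : complex) (f g : chain_map X Y) : Prop :=
  exists h : forall i : int, mor (X (i + 1)) (Y i),
    forall i : int,
      f (i + 1) - g (i + 1) = diff Y i \oc h i + h (i + 1) \oc diff X (i + 1).

(* Homotopy equivalences, i.e. isomorphisms of the homotopy category. *)
Definition homotopy_equiv (X Y : complex) (f : chain_map X Y) : Prop :=
  exists g : chain_map Y X,
    homotopic (compc g f) (idc X) /\ homotopic (compc f g) (idc Y).

Program Definition shift (X : complex) : complex :=
  Complex (cx := fun i => X (i + 1)) (diff := fun i => - diff X (i + 1)) _ _.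
Next Obligation. by move=> X i; rewrite compNm compmN opprK diffK. Qed.
Next Obligation.
move=> X; have [N XN] := bounded_above X; exists N => i Ni; apply: XN.
by rewrite (lt_trans Ni) // ltrDl.
Qed.

Program Definition shiftm (X Y : complex) (f : chain_map X Y) :
    chain_map (shift X) (shift Y) :=
  ChainMap (cm := fun i => f (i + 1)) _.
Next Obligation. by move=> X Y f i /=; rewrite compNm compmN cmP. Qed.

(* The object A in degree 0. *)
Definition stalk_obj (A : C) (b : bool) : C := if b then A else zobj.

Program Definition stalk (A : C) : complex :=
  Complex (cx := fun i => stalk_obj A (i == 0)) (diff := fun i => 0) _ _.
Next Obligation. by move=> A i; rewrite comp0m. Qed.
Next Obligation.
by move=> A; exists 0 => i i0; rewrite (gt_eqF i0); exact: zobjP.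
Qed.

(* The tensor product of X with an object A of C in degree 0: the sum over
   p + q = i of X^p \ox (stalk A)^q reduces to X^i \ox A, with differential
   d \ox id_A. *)
Program Definition tensc (X : complex) (A : C) : complex :=
  Complex (cx := fun i => X i \ox A) (diff := fun i => diff X i \om idm A) _ _.
Next Obligation. by move=> X A i; rewrite -tensm_comp diffK tensm0l. Qed.
Next Obligation.
move=> X A; have [N XN] := bounded_above X; exists N => i Ni.
by apply: is_zero_idm; rewrite -tensm1 ((XN i Ni (X i)).1 (idm _)) tensm0l.
Qed.

Program Definition tenscm (X Y : complex) (A B : C) (f : chain_map X Y)
    (g : mor A B) : chain_map (tensc X A) (tensc Y B) :=
  ChainMap (cm := fun i => f i \om g) _.
Next Obligation.
by move=> X Y A B f g i /=; rewrite -!tensm_comp cmP comp1m compm1.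
Qed.

Program Definition runitVc (X : complex) : chain_map X (tensc X mon_unit) :=
  ChainMap (cm := fun i => runitV (X i)) _.
Next Obligation.
move=> X i /=; rewrite -[LHS]comp1m -runitK -compA.
by rewrite (compA (runit _)) runit_nat -(compA (diff X i)) runitVK compm1.
Qed.

Program Definition assocVc (X : complex) (A B : C) :
    chain_map (tensc X (A \ox B)) (tensc (tensc X A) B) :=
  ChainMap (cm := fun i => assocV (X i) A B) _.
Next Obligation.
move=> X A B i /=; rewrite -[LHS]comp1m -assocK -compA.
rewrite (compA (assoc _ _ _)) assoc_nat -(compA (_ \om _)) assocVK compm1.
by rewrite tensm1.
Qed.

(* The canonical isomorphism 1 \ox A -> A, for 1 and A in degree 0. *)
Definition lunit_stalk (A : C) (b : bool) :
    mor (stalk_obj mon_unit b \ox A) (stalk_obj A b) :=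
  match b return mor (stalk_obj mon_unit b \ox A) (stalk_obj A b) with
  | true => lunit A
  | false => 0
  end.

Program Definition lunitc (A : C) :
    chain_map (tensc (stalk mon_unit) A) (stalk A) :=
  ChainMap (cm := fun i => lunit_stalk A (i == 0)) _.
Next Obligation. by move=> A i /=; rewrite tensm0l comp0m compm0. Qed.

Section Cone.
Context {X Y : complex} (f : chain_map X Y).

Definition cone_obj (i : int) : C := dsum (X (i + 1)) (Y i).

Definition cone_diff (i : int) : mor (cone_obj i) (cone_obj (i + 1)) :=
  injl _ _ \oc (- diff X (i + 1)) \oc projl _ _
  + injr _ _ \oc (f (i + 1) \oc projl _ _ + diff Y i \oc projr _ _).

Lemma cone_diffK (i : int) : cone_diff (i + 1) \oc cone_diff i = 0.
Proof.
rewrite /cone_diff; set a := diff X _; set a' := diff X _.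
rewrite compDm !compmD.
have E1 (D : C) (u : mor D _) :
    projl (X (i + 1 + 1)) (Y (i + 1)) \oc (injl _ _ \oc u) = u.
  by rewrite compA projl_injl comp1m.
have E2 (D : C) (u : mor D _) :
    projl (X (i + 1 + 1)) (Y (i + 1)) \oc (injr _ _ \oc u) = 0.
  by rewrite compA projl_injr comp0m.
have E3 (D : C) (u : mor D _) :
    projr (X (i + 1 + 1)) (Y (i + 1)) \oc (injl _ _ \oc u) = 0.
  by rewrite compA projr_injl comp0m.
have E4 (D : C) (u : mor D _) :
    projr (X (i + 1 + 1)) (Y (i + 1)) \oc (injr _ _ \oc u) = u.
  by rewrite compA projr_injr comp1m.
rewrite -!compA !compDm -!compA !(E1, E2, E3, E4) !compm0 !addr0 !add0r.
rewrite !compNm !compmN !opprK (compA a a') diffK comp0m compm0 add0r.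
rewrite (compA (diff Y (i + 1)) (f (i + 1))) cmP.
rewrite (compA (diff Y (i + 1)) (diff Y i)) diffK comp0m compm0 addr0.
by rewrite -!compA addNr.
Qed.

Lemma cone_bounded :
  exists N : int, forall i : int, N < i -> is_zero (cone_obj i).
Proof.
have [N XN] := bounded_above X; have [M YM] := bounded_above Y.
exists (Num.max N M) => i; rewrite gt_max => /andP[Ni Mi].
have Ni1 : N < i + 1 by rewrite (lt_trans Ni) // ltrDl.
apply: is_zero_idm; rewrite -dsum_id ((XN _ Ni1 _).2 (projl _ _)).
by rewrite ((YM _ Mi _).2 (projr _ _)) !compm0 addr0.
Qed.

Definition cone : complex := Complex cone_diffK cone_bounded.

Program Definition cone_in : chain_map Y cone :=
  ChainMap (cm := fun i => injr (X (i + 1)) (Y i)) _.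
Next Obligation.
move=> i; rewrite /= /cone_diff compDm -!compA projl_injr !compm0 add0r.
by rewrite compDm -!compA projl_injr projr_injr compm0 add0r compm1.
Qed.

Program Definition cone_out : chain_map cone (shift X) :=
  ChainMap (cm := fun i => projl (X (i + 1)) (Y i)) _.
Next Obligation.
move=> i; rewrite /= /cone_diff [RHS]compmD !compA projl_injl projl_injr comp1m.
by rewrite !comp0m addr0.
Qed.

End Cone.

Record triangle := Triangle {
  tri1 : complex;
  tri2 : complex;
  tri3 : complex;
  tri12 : chain_map tri1 tri2;
  tri23 : chain_map tri2 tri3;
  tri31 : chain_map tri3 (shift tri1)
}.

(* The morphisms a, b, c, a[1] form an isomorphism of triangles in the
   homotopy category. *)
Definition triangle_iso (T T' : triangle)
    (a : chain_map (tri1 T) (tri1 T')) (b : chain_map (tri2 T) (tri2 T'))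
    (c : chain_map (tri3 T) (tri3 T')) : Prop :=
  [/\ homotopy_equiv a, homotopy_equiv b & homotopy_equiv c] /\
  [/\ homotopic (compc b (tri12 T)) (compc (tri12 T') a),
      homotopic (compc c (tri23 T)) (compc (tri23 T') b)
    & homotopic (compc (shiftm a) (tri31 T)) (compc (tri31 T') c)].

Definition cone_triangle (X Y : complex) (f : chain_map X Y) : triangle :=
  Triangle f (cone_in f) (cone_out f).

Definition distinguished (T : triangle) : Prop :=
  exists (X Y : complex) (f : chain_map X Y),
  exists a b c, @triangle_iso T (cone_triangle f) a b c.

Record self_dual := SelfDual {
  sd_obj :> C;
  ev : mor (sd_obj \ox sd_obj) mon_unit;
  coev : mor mon_unit (sd_obj \ox sd_obj);
  sd_zigzagl :
    runit sd_obj \oc (idm sd_obj \om ev) \oc assoc sd_obj sd_obj sd_obj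
      \oc (coev \om idm sd_obj) \oc lunitV sd_obj = idm sd_obj;
  sd_zigzagr :
    lunit sd_obj \oc (ev \om idm sd_obj) \oc assocV sd_obj sd_obj sd_obj
      \oc (idm sd_obj \om coev) \oc runitV sd_obj = idm sd_obj
}.

Definition self_dual_iso (V V' : self_dual) (phi : mor V V') : Prop :=
  [/\ is_iso phi,
      (phi \om phi) \oc coev V = coev V'
    & ev V' \oc (phi \om phi) = ev V].

(* Given W m standing for V^{(m+2)}, the whole family V^{(n)}, where
   V^{(0)} = 1 and V^{(1)} = V hold by definition. *)
Definition cheb_family (V : C) (W : nat -> complex) (n : nat) : complex :=
  match n with
  | 0%N => stalk mon_unit
  | 1%N => stalk V
  | m.+2 => W m
  end.

(* Given p m standing for pi^{(m+2)}, [cheb_maps p n] is pi^{(n+1)}, where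
   pi^{(1)} is the canonical isomorphism. *)
Definition cheb_maps (V : C) (W : nat -> complex)
    (p : forall m, chain_map (tensc (cheb_family V W m.+1) V) (W m)) (n : nat) :
    chain_map (tensc (cheb_family V W n) V) (cheb_family V W n.+1) :=
  match n with
  | 0%N => lunitc V
  | m.+1 => p m
  end.

(* (p \ox id_V) \oc (id_X \ox coev), with the coherence isomorphisms
   X = X \ox 1 and X \ox (V \ox V) = (X \ox V) \ox V. *)
Definition cheb_iota (V : self_dual) (X Y : complex)
    (p : chain_map (tensc X V) Y) : chain_map X (tensc Y V) :=
  compc (tenscm p (idm V))
    (compc (assocVc X V V) (compc (tenscm (idc X) (coev V)) (runitVc X))).

(* The third map [cheb_d] of the distinguished triangles is part of the data,
   so that the triangles themselves are determined by the system; all maps of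
   the homotopy category are given by representing chain maps. *)
Record chebyshev_system := ChebyshevSystem {
  cheb_V : self_dual;
  cheb_W : nat -> complex;
  cheb_p : forall m : nat,
    chain_map (tensc (cheb_family cheb_V cheb_W m.+1) cheb_V) (cheb_W m);
  cheb_d : forall m : nat,
    chain_map (cheb_W m) (shift (cheb_family cheb_V cheb_W m));
  cheb_distinguished : forall m : nat,
    distinguished
      (Triangle (cheb_iota (cheb_maps cheb_p m)) (cheb_p m) (cheb_d m))
}.

Definition cheb (S : chebyshev_system) (n : nat) : complex :=
  cheb_family (cheb_V S) (cheb_W S) n.

(* The distinguished triangle
   V^{(n)} -> V^{(n+1)} \ox V -> V^{(n+2)} -> V^{(n)}[1] of S. *)
Definition cheb_triangle (S : chebyshev_system) (n : nat) : triangle :=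
  @Triangle (cheb S n) (tensc (cheb S n.+1) (cheb_V S)) (cheb S n.+2)
    (cheb_iota (cheb_maps (cheb_p S) n)) (cheb_p S n) (cheb_d S n).

End Complexes.

Arguments complex {k} C.
Arguments triangle {k} C.
Arguments self_dual {k} C.
Arguments chebyshev_system {k} C.

(* Main.v *)
Require Import Defs.
From mathcomp Require Import all_boot all_order all_algebra.
From Stdlib Require Import Setoid Morphisms IndefiniteDescription.

(** A Chebyshev system is determined recursively: its triangles say that
    [cheb S n.+2] is a cone of the map [cheb_iota] built
    from [cheb_maps (cheb_p S) n], which involves only the terms [n] and [n.+1],
    and cones are unique up to isomorphism in the homotopy category.  So the
    maps [theta n] are built two at a time.  The induction hypothesis is that
    [theta n] and [theta n.+1] are homotopy equivalences intertwining the
    maps pi^(n+1) up to homotopy.  Compatibility of [phi] with the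
    coevaluations turns this into a homotopy commutative square between the
    maps iota^(n) ([cheb_iota_nat]); completing the square to an isomorphism
    of triangles ([distinguished_fill]) gives [theta n.+2], and the middle
    square of that isomorphism is the next induction hypothesis.  The
    recursion starts with the identity of the unit and with [phi] in degree 0,
    where the hypothesis is naturality of the left unitor ([stalkm_lunit]).

    Completing a square uses the axiom TR3 and the five lemma for the homotopy
    category.  After transport to cones, a homotopy filling the square is
    exactly the off-diagonal entry of a chain map of cones ([cone_map]).
    Filling the inverse square too gives maps c and c' back and forth whose
    composites c' c and c c' fix, up to homotopy, the inclusion into the cone
    and the projection out of it.  Such an endomorphism e of a cone is
    invertible ([cone_endo_equiv]): by exactness e is homotopic to 1 + u out
    for some u ([cone_exact]), and out e being homotopic to out makes u out
    square to zero, so 1 - u out is an inverse.  Hence c is a homotopy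
    equivalence.

    The map completing a square is not unique, so the sequence is extracted by
    choice ([two_step_choice]). *)

Section ChebyshevUniqueness.
Set Implicit Arguments.
Unset Strict Implicit.
Unset Printing Implicit Defensive.
Import GRing.Theory Defs.
Local Open Scope ring_scope.
Local Open Scope cat_scope.

(** * Chain maps up to homotopy *)

Section HomotopyCategory.
Context {k : comPzRingType} {C : monoidal_category k}.
Implicit Types X Y Z W : complex C.

Lemma homotopic_pointwise X Y (f g : chain_map X Y) :
  (forall i, f i = g i) -> homotopic f g.
Proof.
move=> fg; exists (fun i => 0) => i.
by rewrite fg subrr compm0 comp0m addr0.
Qed.

Lemma homotopic_refl X Y (f : chain_map X Y) : homotopic f f.
Proof. exact: homotopic_pointwise. Qed.
#[local] Hint Resolve homotopic_refl : core.

Lemma homotopic_sym X Y (f g : chain_map X Y) :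
  homotopic f g -> homotopic g f.
Proof.
move=> [h hE]; exists (fun i => - h i) => i.
by rewrite compmN compNm -opprD -hE opprB.
Qed.

Lemma homotopic_trans X Y (f g u : chain_map X Y) :
  homotopic f g -> homotopic g u -> homotopic f u.
Proof.
move=> [h hE] [l lE]; exists (fun i => h i + l i) => i.
by rewrite compmD compDm addrACA -hE -lE addrA subrK.
Qed.

#[local] Instance homotopic_equivalence X Y :
  Equivalence (@homotopic k C X Y).
Proof.
split=> [f|f g|f g u].
- exact: homotopic_refl.
- exact: homotopic_sym.
- exact: homotopic_trans.
Qed.

#[local] Instance compc_homotopic X Y Z :
  Proper (@homotopic k C Y Z ==> @homotopic k C X Y ==> @homotopic k C X Z)
    (@compc k C X Y Z).
Proof.
move=> g g' [l lE] f f' [h hE].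
apply: (@homotopic_trans _ _ _ (compc g f')).
  exists (fun i => g i \oc h i) => i /=.
  by rewrite -compmN -compmD hE compmD !compA cmP.
exists (fun i => l i \oc f' (i + 1)) => i /=.
by rewrite -compNm -compDm lE compDm -!compA cmP.
Qed.

Lemma compcA X Y Z W (u : chain_map Z W) (g : chain_map Y Z)
    (f : chain_map X Y) :
  homotopic (compc u (compc g f)) (compc (compc u g) f).
Proof. by apply: homotopic_pointwise => i; exact: compA. Qed.

Lemma compidc X Y (f : chain_map X Y) : homotopic (compc (idc Y) f) f.
Proof. by apply: homotopic_pointwise => i; exact: comp1m. Qed.

Lemma compcid X Y (f : chain_map X Y) : homotopic (compc f (idc X)) f.
Proof. by apply: homotopic_pointwise => i; exact: compm1. Qed.

Lemma shiftm_homotopic X Y (f g : chain_map X Y) :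
  homotopic f g -> homotopic (shiftm f) (shiftm g).
Proof.
move=> [h hE]; exists (fun i => - h (i + 1)) => i /=.
by rewrite hE !compmN !compNm !opprK.
Qed.

Lemma shiftm_comp X Y Z (g : chain_map Y Z) (f : chain_map X Y) :
  homotopic (shiftm (compc g f)) (compc (shiftm g) (shiftm f)).
Proof. exact: homotopic_pointwise. Qed.

Lemma shiftm_id X : homotopic (shiftm (idc X)) (idc (shift X)).
Proof. exact: homotopic_pointwise. Qed.

Lemma tensmDl (A A' B B' : C) (f f' : mor A A') (g : mor B B') :
  (f + f') \om g = f \om g + f' \om g.
Proof. by have := tensm_linearl 1 f f' g; rewrite !scale1r. Qed.

Lemma tensmNl (A A' B B' : C) (f : mor A A') (g : mor B B') :
  (- f) \om g = - (f \om g).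
Proof. by apply: (addIr (f \om g)); rewrite -tensmDl !addNr tensm0l. Qed.

Lemma tenscm_homotopic X Y (A B : C) (f f' : chain_map X Y) (g : mor A B) :
  homotopic f f' -> homotopic (tenscm f g) (tenscm f' g).
Proof.
move=> [h hE]; exists (fun i => h i \om g) => i /=.
rewrite -tensmNl -tensmDl hE tensmDl.
by rewrite -!tensm_comp comp1m compm1.
Qed.

Lemma tenscm_comp X Y Z (A B D : C) (f' : chain_map Y Z) (f : chain_map X Y)
    (g' : mor B D) (g : mor A B) :
  homotopic (tenscm (compc f' f) (g' \oc g))
    (compc (tenscm f' g') (tenscm f g)).
Proof. by apply: homotopic_pointwise => i; exact: tensm_comp. Qed.

Lemma tenscm_id X (A : C) : homotopic (tenscm (idc X) (idm A)) (idc _).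
Proof. by apply: homotopic_pointwise => i; exact: tensm1. Qed.

Definition homotopy_inverse X Y (f : chain_map X Y) (g : chain_map Y X) :=
  homotopic (compc g f) (idc X) /\ homotopic (compc f g) (idc Y).

Lemma homotopy_inverse_sym X Y (f : chain_map X Y) (g : chain_map Y X) :
  homotopy_inverse f g -> homotopy_inverse g f.
Proof. by case. Qed.

Lemma homotopy_equiv_comp X Y Z (g : chain_map Y Z) (f : chain_map X Y) :
  homotopy_equiv g -> homotopy_equiv f -> homotopy_equiv (compc g f).
Proof.
move=> [g' [gl gr]] [f' [fl fr]]; exists (compc f' g'); split.
  by rewrite compcA -(compcA f' g' g) gl compcid fl.
by rewrite compcA -(compcA g f f') fr compcid gr.
Qed.

Lemma homotopy_equiv_homotopic X Y (f f' : chain_map X Y) :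
  homotopic f f' -> homotopy_equiv f -> homotopy_equiv f'.
Proof. by move=> ff' [g [gl gr]]; exists g; split; rewrite -ff'. Qed.

Lemma homotopy_equiv_tens X Y (A B : C) (f : chain_map X Y) (g : mor A B) :
  homotopy_equiv f -> is_iso g -> homotopy_equiv (tenscm f g).
Proof.
move=> [f' [fl fr]] [g' [gl gr]]; exists (tenscm f' g'); split.
  by rewrite -tenscm_comp gl (tenscm_homotopic _ fl) tenscm_id.
by rewrite -tenscm_comp gr (tenscm_homotopic _ fr) tenscm_id.
Qed.

(** A map with a left inverse l g and a right inverse g r is invertible; this
    gets at [f] through its two composites with [g], which are endomorphisms
    and so easier to control. *)
Lemma homotopy_equiv_two_sided X Y (f : chain_map X Y) (g : chain_map Y X) :
  homotopy_equiv (compc g f) -> homotopy_equiv (compc f g) ->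
  homotopy_equiv f.
Proof.
move=> [l [l1 _]] [r [_ r1]]; exists (compc l g).
have fr : homotopic (compc (compc l g) f) (idc X) by rewrite -compcA l1.
split=> //.
have -> : homotopic (compc l g) (compc g r).
  rewrite -(compcid (compc l g)) -r1 compcA compcA fr.
  by rewrite compidc.
by rewrite compcA r1.
Qed.

Program Definition addc X Y (f g : chain_map X Y) : chain_map X Y :=
  ChainMap (cm := fun i => f i + g i) _.
Next Obligation. by rewrite compmD compDm !cmP. Qed.

Program Definition subc X Y (f g : chain_map X Y) : chain_map X Y :=
  ChainMap (cm := fun i => f i - g i) _.
Next Obligation.
by rewrite compmD compDm compmN compNm !cmP.
Qed.

#[local] Instance addc_homotopic X Y :
  Proper (@homotopic k C X Y ==> @homotopic k C X Y ==> @homotopic k C X Y)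
    (@addc X Y).
Proof.
move=> f f' [h hE] g g' [l lE]; exists (fun i => h i + l i) => i /=.
by rewrite compmD compDm addrACA -hE -lE opprD addrACA.
Qed.

#[local] Instance subc_homotopic X Y :
  Proper (@homotopic k C X Y ==> @homotopic k C X Y ==> @homotopic k C X Y)
    (@subc X Y).
Proof.
move=> f f' [h hE] g g' [l lE]; exists (fun i => h i - l i) => i /=.
rewrite compmD compDm compmN compNm addrACA -opprD -hE -lE.
by rewrite !opprD !opprK addrACA.
Qed.

(** The two hypotheses give w w ~ 0, so 1 - w inverts e ~ 1 + w.  The condition
    is put as w e ~ w because for w = u out it then follows at once from
    out e ~ out. *)
Lemma unipotent_homotopy_equiv X (e w : chain_map X X) :
  homotopic e (addc (idc X) w) -> homotopic (compc w e) w ->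
  homotopy_equiv e.
Proof.
move=> eE we.
have ew : homotopic (compc e w) w.
  rewrite -{2}we eE; apply: homotopic_pointwise => i /=.
  by rewrite compmD compDm comp1m compm1.
have sE : homotopic (subc (addc (idc X) w) w) (idc X).
  by apply: homotopic_pointwise => i; exact: addrK.
exists (subc (idc X) w); split.
  have -> : homotopic (compc (subc (idc X) w) e) (subc e (compc w e)).
    by apply: homotopic_pointwise => i /=; rewrite compDm compNm comp1m.
  by rewrite we eE.
have -> : homotopic (compc e (subc (idc X) w)) (subc e (compc e w)).
  by apply: homotopic_pointwise => i /=; rewrite compmD compmN compm1.
by rewrite ew eE.
Qed.

(** * Maps out of and between cones *)

Lemma dsum_ext (A B D : C) (f g : mor (dsum A B) D) :
  f \oc injl A B = g \oc injl A B -> f \oc injr A B = g \oc injr A B -> f = g.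
Proof.
move=> fgl fgr; rewrite -[f]compm1 -[g]compm1 -dsum_id !compmD.
by rewrite !(compA f) !(compA g) fgl fgr.
Qed.

Lemma cone_diff_injl X Y (f : chain_map X Y) i :
  cone_diff f i \oc injl _ _ =
    - (injl _ _ \oc diff X (i + 1)) + injr _ _ \oc f (i + 1).
Proof.
rewrite /cone_diff compDm -!compA compDm -!compA projl_injl projr_injl.
by rewrite compm0 addr0 !compm1 compmN.
Qed.

Lemma cone_diff_injr X Y (f : chain_map X Y) i :
  cone_diff f i \oc injr _ _ = injr _ _ \oc diff Y i.
Proof.
rewrite /cone_diff compDm -!compA compDm -!compA projl_injr projr_injr.
by rewrite !compm0 !add0r compm1.
Qed.

(** Exactness at the cone of Hom(cone f, Z): a map p - q that vanishes up to
    homotopy on Y factors up to homotopy through the projection to X[1].  With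
    h a homotopy from p in to q in, the null-homotopic part of p - q is the
    boundary of h projr, and what remains factors as
    u = (p - q) injl - h f. *)
Lemma cone_exact X Y Z (f : chain_map X Y) (p q : chain_map (cone f) Z) :
  homotopic (compc p (cone_in f)) (compc q (cone_in f)) ->
  exists u : chain_map (shift X) Z,
    homotopic p (addc q (compc u (cone_out f))).
Proof.
move=> [h hE].
(* Keeping r = p - q abstract stops distributivity from splitting it. *)
have [r rpq] : {r : chain_map (cone f) Z | forall i, r i = p i - q i}.
  by exists (subc p q).
have rE i : r (i + 1) \oc injr _ _ =
    diff Z i \oc h i + h (i + 1) \oc diff Y (i + 1).
  by rewrite -hE rpq /= compDm compNm.
pose u i : mor (shift X i) (Z i) := r i \oc injl _ _ - h i \oc f (i + 1).
have uP i : diff Z i \oc u i = u (i + 1) \oc diff (shift X) i.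
  rewrite /u compmD compmN !compA cmP -compA cone_diff_injl compmD compmN.
  rewrite (compA _ _ (f (i + 1))) rE compDm addrA addrAC addrK.
  by rewrite [RHS]compmN compDm compNm opprD opprK -!compA cmP.
exists (ChainMap uP), (fun i => h i \oc projr _ _) => i.
have -> : p (i + 1) - addc q (compc (ChainMap uP) (cone_out f)) (i + 1) =
    r (i + 1) - u (i + 1) \oc projl _ _ by rewrite rpq /= opprD addrA.
apply: dsum_ext.
  rewrite compDm compNm -compA projl_injl compm1 /u opprD opprK addrA subrr.
  rewrite add0r compDm -!compA projr_injl !compm0 add0r cone_diff_injl.
  rewrite compmD compmN !compA projr_injl comp0m oppr0 add0r.
  by rewrite projr_injr comp1m.
rewrite compDm compNm -compA projl_injr compm0 subr0 rE compDm.
by rewrite -!compA cone_diff_injr !compA -!(compA _ (projr _ _)) !projr_injr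
  !compm1.
Qed.

Lemma cone_endo_equiv X Y (f : chain_map X Y)
    (e : chain_map (cone f) (cone f)) :
  homotopic (compc e (cone_in f)) (cone_in f) ->
  homotopic (compc (cone_out f) e) (cone_out f) ->
  homotopy_equiv e.
Proof.
move=> ein eout.
have [|u eE] := @cone_exact _ _ _ f e (idc _); first by rewrite compidc.
by apply: unipotent_homotopy_equiv eE _; rewrite -compcA eout.
Qed.

(** TR3 for cones: the chain map is the triangular matrix with diagonal entries
    a[1] and b, and with a homotopy from b f to f' a as the remaining entry. *)
Lemma cone_map X Y X' Y' (f : chain_map X Y) (f' : chain_map X' Y')
    (a : chain_map X X') (b : chain_map Y Y') :
  homotopic (compc b f) (compc f' a) ->
  exists c : chain_map (cone f) (cone f'),
    homotopic (compc c (cone_in f)) (compc (cone_in f') b) /\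
    homotopic (compc (cone_out f') c) (compc (shiftm a) (cone_out f)).
Proof.
move=> [h hE].
pose c i : mor (cone f i) (cone f' i) :=
  injl _ _ \oc a (i + 1) \oc projl _ _
  + injr _ _ \oc (h i \oc projl _ _ + b i \oc projr _ _).
have cl i : c i \oc injl _ _ = injl _ _ \oc a (i + 1) + injr _ _ \oc h i.
  rewrite /c compDm -!compA compDm -!compA projl_injl projr_injl.
  by rewrite compm0 addr0 !compm1.
have cr i : c i \oc injr _ _ = injr _ _ \oc b i.
  rewrite /c compDm -!compA compDm -!compA projl_injr projr_injr.
  by rewrite !compm0 !add0r compm1.
have cP i : diff (cone f') i \oc c i = c (i + 1) \oc diff (cone f) i.
  apply: dsum_ext; rewrite -!compA.
    rewrite cl cone_diff_injl !compmD compmN !compA.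
    rewrite cone_diff_injl cone_diff_injr cl cr compDm compNm.
    rewrite !compDm opprD -!compA cmP -[LHS]addrA -[RHS]addrA; congr (_ + _).
    have /eqP := hE i; rewrite /= subr_eq => /eqP ->.
    by rewrite [RHS]addrC !compmD [RHS]addrAC addrK [LHS]addrC.
  by rewrite cr cone_diff_injr !compA cone_diff_injr cr -!compA cmP.
exists (ChainMap cP); split; apply: homotopic_pointwise => i /=.
  exact: cr.
rewrite /c [LHS]compmD !compA projl_injl projl_injr comp1m.
by rewrite !comp0m addr0.
Qed.

(** * Filling squares between distinguished triangles *)

Lemma square_inverse X Y X' Y' (f : chain_map X Y) (f' : chain_map X' Y')
    (a : chain_map X X') (a' : chain_map X' X)
    (b : chain_map Y Y') (b' : chain_map Y' Y) :
  homotopy_inverse a a' -> homotopy_inverse b b' ->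
  homotopic (compc b f) (compc f' a) -> homotopic (compc b' f') (compc f a').
Proof.
move=> [_ ar] [bl _] fab.
rewrite -(compcid (compc b' f')) -ar compcA -(compcA b') -fab.
by rewrite (compcA b') bl compidc.
Qed.

(** The five lemma for cones: fill both the square and the inverse square, then
    apply [cone_endo_equiv] to the two composites. *)
Lemma cone_triangle_map_equiv X Y X' Y' (f : chain_map X Y)
    (f' : chain_map X' Y') (a : chain_map X X') (b : chain_map Y Y') :
  homotopy_equiv a -> homotopy_equiv b ->
  homotopic (compc b f) (compc f' a) ->
  exists c, triangle_iso (T := cone_triangle f) (T' := cone_triangle f') a b c.
Proof.
move=> ha hb fab.
have [a' [al ar]] := ha; have [b' [bl br]] := hb.
have fab' : homotopic (compc b' f') (compc f a').
  by apply: square_inverse fab; split.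
have [c [cin cout]] := cone_map fab.
have [c' [cin' cout']] := cone_map fab'.
exists c; split; last by split=> //; symmetry.
split=> //; apply: (@homotopy_equiv_two_sided _ _ c c'); apply: cone_endo_equiv.
- by rewrite -compcA cin compcA cin' -compcA bl compcid.
- by rewrite compcA cout' -compcA cout compcA -shiftm_comp
    (shiftm_homotopic al) shiftm_id compidc.
- by rewrite -compcA cin' compcA cin -compcA br compcid.
- by rewrite compcA cout -compcA cout' compcA -shiftm_comp
    (shiftm_homotopic ar) shiftm_id compidc.
Qed.

Lemma triangle_iso_trans (T T' T'' : triangle C)
    (a : chain_map (tri1 T) (tri1 T')) (b : chain_map (tri2 T) (tri2 T'))
    (c : chain_map (tri3 T) (tri3 T')) (a' : chain_map (tri1 T') (tri1 T''))
    (b' : chain_map (tri2 T') (tri2 T'')) (c' : chain_map (tri3 T') (tri3 T'')) :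
  triangle_iso a' b' c' -> triangle_iso a b c ->
  triangle_iso (compc a' a) (compc b' b) (compc c' c).
Proof.
move=> [[ha' hb' hc'] [e1' e2' e3']] [[ha hb hc] [e1 e2 e3]].
split; split; try exact: homotopy_equiv_comp.
- by rewrite -compcA e1 compcA e1' compcA.
- by rewrite -compcA e2 compcA e2' compcA.
- by rewrite shiftm_comp -compcA e3 compcA e3' compcA.
Qed.

Lemma triangle_iso_inverse (T T' : triangle C)
    (a : chain_map (tri1 T) (tri1 T')) (b : chain_map (tri2 T) (tri2 T'))
    (c : chain_map (tri3 T) (tri3 T')) (a' : chain_map (tri1 T') (tri1 T))
    (b' : chain_map (tri2 T') (tri2 T)) (c' : chain_map (tri3 T') (tri3 T)) :
  homotopy_inverse a a' -> homotopy_inverse b b' -> homotopy_inverse c c' ->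
  triangle_iso a b c -> triangle_iso a' b' c'.
Proof.
move=> aa' bb' cc' [_ [e1 e2 e3]].
have [a'a b'b c'c] := And3 (homotopy_inverse_sym aa')
  (homotopy_inverse_sym bb') (homotopy_inverse_sym cc').
have sa : homotopy_inverse (shiftm a) (shiftm a').
  case: aa' => al ar; split; rewrite -shiftm_comp.
    by rewrite (shiftm_homotopic al) shiftm_id.
  by rewrite (shiftm_homotopic ar) shiftm_id.
split; split; try by [exists a | exists b | exists c].
- exact: square_inverse e1.
- exact: square_inverse e2.
- exact: square_inverse e3.
Qed.

Lemma triangle_iso_homotopic (T T' : triangle C)
    (a a' : chain_map (tri1 T) (tri1 T')) (b b' : chain_map (tri2 T) (tri2 T'))
    (c : chain_map (tri3 T) (tri3 T')) :
  homotopic a a' -> homotopic b b' ->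
  triangle_iso a b c -> triangle_iso a' b' c.
Proof.
move=> aa bb [[ha hb hc] [e1 e2 e3]].
split; split=> //.
- exact: homotopy_equiv_homotopic ha.
- exact: homotopy_equiv_homotopic hb.
- by rewrite -aa -bb.
- by rewrite -bb.
- by rewrite -(shiftm_homotopic aa).
Qed.

(** The isomorphisms of [T] and [T'] with cone triangles conjugate [a] and [b]
    into maps between cones, which fill; conjugating back returns [a] and [b]
    only up to homotopy. *)
Lemma distinguished_fill (T T' : triangle C)
    (a : chain_map (tri1 T) (tri1 T')) (b : chain_map (tri2 T) (tri2 T')) :
  distinguished T -> distinguished T' ->
  homotopy_equiv a -> homotopy_equiv b ->
  homotopic (compc b (tri12 T)) (compc (tri12 T') a) ->
  exists c, triangle_iso a b c.
Proof.
move=> [X [Y [f [u [v [w uvw]]]]]] [X' [Y' [f' [u' [v' [w' uvw']]]]]] ha hb sq.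
have [[[ui iu] [vi iv] [wi iw]] [e1 _ _]] := uvw.
have [[[ui' iu'] [vi' iv'] [wi' iw']] [e1' _ _]] := uvw'.
have inv := triangle_iso_inverse iu' iv' iw' uvw'.
have hu : homotopy_equiv ui by exists u; exact: homotopy_inverse_sym iu.
have hv : homotopy_equiv vi by exists v; exact: homotopy_inverse_sym iv.
have hu' : homotopy_equiv u' by exists ui'.
have hv' : homotopy_equiv v' by exists vi'.
have [|||c abc] := @cone_triangle_map_equiv _ _ _ _ f f'
    (compc u' (compc a ui)) (compc v' (compc b vi)).
- exact: homotopy_equiv_comp hu' (homotopy_equiv_comp ha hu).
- exact: homotopy_equiv_comp hv' (homotopy_equiv_comp hb hv).
- have e2 : homotopic (compc vi f) (compc (tri12 T) ui).
    exact: square_inverse e1.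
  rewrite -!compcA e2 (compcA b) sq -(compcA _ a) (compcA v').
  have e3 : homotopic (compc v' (tri12 T')) (compc f' u') by [].
  by rewrite e3 -!compcA.
exists (compc wi' (compc c w)).
apply: triangle_iso_homotopic
  (triangle_iso_trans inv (triangle_iso_trans abc uvw)).
- by rewrite !compcA iu'.1 compidc -compcA iu.1 compcid.
- by rewrite !compcA iv'.1 compidc -compcA iv.1 compcid.
Qed.

(** * The structure maps of a Chebyshev system *)

Lemma assocV_nat (A A' B B' D D' : C) (f : mor A A') (g : mor B B')
    (h : mor D D') :
  ((f \om g) \om h) \oc assocV A B D = assocV A' B' D' \oc (f \om (g \om h)).
Proof.
rewrite -[LHS]comp1m -assocK -compA (compA (assoc _ _ _)) assoc_nat.
by rewrite -(compA (_ \om _)) assocVK compm1.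
Qed.

Lemma runitV_nat (A A' : C) (f : mor A A') :
  (f \om idm mon_unit) \oc runitV A = runitV A' \oc f.
Proof.
rewrite -[LHS]comp1m -runitK -compA (compA (runit _)) runit_nat.
by rewrite -(compA f) runitVK compm1.
Qed.

(** Every factor of iota is natural in X and Y; the coevaluation is carried to
    that of [V'] because [phi] is compatible with it. *)
Lemma cheb_iota_nat (V V' : self_dual C) (phi : mor V V') X Y X' Y'
    (p : chain_map (tensc X V) Y) (p' : chain_map (tensc X' V') Y')
    (a : chain_map X X') (b : chain_map Y Y') :
  (phi \om phi) \oc coev V = coev V' ->
  homotopic (compc b p) (compc p' (tenscm a phi)) ->
  homotopic (compc (tenscm b phi) (cheb_iota p)) (compc (cheb_iota p') a).
Proof.
move=> phi_coev bp; rewrite /cheb_iota.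
have -> : homotopic (compc (tenscm b phi) (compc (tenscm p (idm V))
    (compc (assocVc X V V) (compc (tenscm (idc X) (coev V)) (runitVc X)))))
    (compc (tenscm (compc b p) phi)
    (compc (assocVc X V V) (compc (tenscm (idc X) (coev V)) (runitVc X)))).
  by rewrite compcA -tenscm_comp compm1.
rewrite (tenscm_homotopic _ bp).
have -> : homotopic (tenscm (compc p' (tenscm a phi)) phi)
    (compc (tenscm p' (idm V')) (tenscm (tenscm a phi) phi)).
  by rewrite -tenscm_comp comp1m.
rewrite -!compcA; apply: compc_homotopic => //.
apply: homotopic_pointwise => i /=.
rewrite compA assocV_nat -!compA; congr (_ \oc _).
rewrite compA -tensm_comp phi_coev compm1 -runitV_nat compA -tensm_comp.
by rewrite comp1m compm1.
Qed.

Program Definition stalkm (A B : C) (f : mor A B) :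
    chain_map (stalk A) (stalk B) :=
  ChainMap (cm := fun i =>
    (if i == 0 as b return mor (stalk_obj A b) (stalk_obj B b)
     then f else 0)) _.
Next Obligation. by rewrite comp0m compm0. Qed.

Lemma stalkm_equiv (A B : C) (f : mor A B) :
  is_iso f -> homotopy_equiv (stalkm f).
Proof.
move=> [g [gf fg]]; exists (stalkm g).
split; apply: homotopic_pointwise => i /=; case: (i == 0) => //=;
  by rewrite ((zobjP _).1 (idm _)) compm0.
Qed.

Lemma stalkm_lunit (A B : C) (f : mor A B) :
  homotopic (compc (stalkm f) (lunitc A)) (compc (lunitc B) (tenscm (idc _) f)).
Proof.
apply: homotopic_pointwise => i /=; case: (i == 0) => /=.
  by rewrite lunit_nat.
by rewrite !comp0m.
Qed.

End HomotopyCategory.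

(** Dependent choice where each new term depends on the previous two.  The
    invariant [R] makes the recursion possible; [T] is the relation that is
    wanted on consecutive triples. *)
Lemma two_step_choice (A : nat -> Type) (R : forall n, A n -> A n.+1 -> Prop)
    (T : forall n, A n -> A n.+1 -> A n.+2 -> Prop) (x0 : A 0%N) (x1 : A 1%N) :
  R 0%N x0 x1 ->
  (forall n x y, R n x y -> exists z, R n.+1 y z /\ T n x y z) ->
  exists x : forall n, A n,
    forall n, R n (x n) (x n.+1) /\ T n (x n) (x n.+1) (x n.+2).
Proof.
move=> R0 step.
pose St n := {s : A n * A n.+1 | R n s.1 s.2}.
have next n (s : St n) : {z | R n.+1 (sval s).2 z /\ T n (sval s).1 (sval s).2 z}.
  exact: constructive_indefinite_description (step _ _ _ (svalP s)).
pose st := fix st n : St n :=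
  if n is m.+1 then
    let s := st m in exist _ ((sval s).2, sval (next m s)) (svalP (next m s)).1
  else exist _ (x0, x1) R0.
exists (fun n => (sval (st n)).1) => n.
by split; [exact: svalP (st n) | exact: (svalP (next n (st n))).2].
Qed.

End ChebyshevUniqueness.

Theorem theorem4p8 (k : comPzRingType) (C : monoidal_category k)
    (S S' : chebyshev_system C) (phi : mor (cheb_V S) (cheb_V S'))
    (hphi : self_dual_iso phi) :
  exists theta : forall n : nat, chain_map (cheb S n) (cheb S' n),
    (forall n : nat, homotopy_equiv (theta n)) /\
    (forall n : nat,
      triangle_iso (T := cheb_triangle S n) (T' := cheb_triangle S' n)
        (theta n) (tenscm (theta n.+1) phi) (theta n.+2)).
Proof.
have [phi_iso phi_coev _] := hphi.
pose square n (x : chain_map (cheb S n) (cheb S' n))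
    (y : chain_map (cheb S n.+1) (cheb S' n.+1)) :=
  homotopic (compc y (cheb_maps (cheb_p S) n))
    (compc (cheb_maps (cheb_p S') n) (tenscm x phi)).
pose R n x y := [/\ homotopy_equiv x, homotopy_equiv y & @square n x y].
pose T n x y z :=
  triangle_iso (T := cheb_triangle S n) (T' := cheb_triangle S' n)
    x (tenscm y phi) z.
have [||theta thetaP] := @two_step_choice
  (fun n => chain_map (cheb S n) (cheb S' n)) R T (idc _) (stalkm phi).
- split; last exact: stalkm_lunit.
  + by exists (idc _); split; exact: compidc.
  + exact: stalkm_equiv.
- move=> n x y [hx hy sq].
  have [z xyz] : exists z, T n x y z.
    apply: distinguished_fill; try exact: cheb_distinguished.
    + exact: hx.
    + exact: homotopy_equiv_tens.
    + exact: cheb_iota_nat.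
  exists z; split=> //; have [[_ _ hz] [_ zsq _]] := xyz.
  by split.
by exists theta; split=> n; have [[]] := thetaP n.
Qed.
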